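(* Let $G=(V,E)$ be a connected chordal graph, let $D\subseteq E$ be the set of edges of $G$ that lie in no $3$-cycle of $G$, let $\mathcal{H}'=(V',\mathcal{E}')$ be a Berge-acyclic subhypergraph of $\mathcal{H}(G)$ with the maximum number of hyperedges, and let $G'=(V,E(G[\mathcal{E}'])\cup D)$. Let $X(G')$ be the graph obtained from $G'$ by repeating the following step while the current graph has more than one connected component: choose two connected components $F_1,F_2$ that can be joined by a single edge $e\in E$ not in the current graph, and replace them by $F_1\cup F_2\cup\{e\}$. Then $X(G')$ is a spanning cactus subgraph of $G$ with the maximum number of edges.
   Context: All graphs are finite, simple and undirected. A graph is chordal if it has no induced cycle of length greater than $3$. A cactus is a connected graph in which every edge lies in at most one cycle; a spanning cactus subgraph of $G$ is a subgraph with vertex set $V(G)$ that is a cactus. A hypergraph is a pair $(V,\mathcal{E})$ with $V$ finite and $\mathcal{E}$ a set of nonempty subsets of $V$; a subhypergraph $(V',\mathcal{E}')$ has $V'\subseteq V$, $\mathcal{E}'\subseteq\mathcal{E}$. A Berge-cycle is a sequence $(E_1,x_1,\dots,E_n,x_n)$, $n\ge 2$, of distinct hyperedges $E_i$ and distinct vertices $x_i$ with $x_i\in E_i\cap E_{i+1}$ for all $i$ (indices mod $n$); a hypergraph is Berge-acyclic if it has no Berge-cycle. $\mathcal{H}(G)=(V,\mathcal{E})$ is the hypergraph whose hyperedges are exactly the $3$-element vertex sets inducing a triangle in $G$. For $\mathcal{E}'\subseteq\mathcal{E}$, $G[\mathcal{E}']$ is the graph whose vertices are those occurring in hyperedges of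 $\mathcal{E}'$, with $u,v$ adjacent iff $\{u,v\}\subseteq e$ for some $e\in\mathcal{E}'$. *)

(* Defs.v *)
(* A finite simple graph is a symmetric irreflexive
   relation [e : rel T] on a finite type [T]; edges are 2-element sets. *)
From mathcomp Require Import all_boot.
Set Implicit Arguments. Unset Strict Implicit. Unset Printing Implicit Defensive.

Section Graphs.
Variable T : finType.

Definition connected_rel (r : rel T) : Prop := forall x y : T, connect r x y.

Definition chordless (e : rel T) (s : seq T) : Prop :=
  forall i j, i < size s -> j < size s -> forall x0 : T,
    e (nth x0 s i) (nth x0 s j) ->
    (j == i.+1 %% size s) || (i == j.+1 %% size s).

Definition chordal (e : rel T) : Prop :=
  ~ exists s : seq T, [/\ uniq s, 3 < size s, cycle e s & chordless e s].

Definition Eset (e : rel T) : {set {set T}} :=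
  [set [set p.1; p.2] | p in [pred p : T * T | e p.1 p.2]].

Definition adjF (F : {set {set T}}) : rel T := fun x y => [set x; y] \in F.

Definition cycle_edges (c : seq T) : {set {set T}} :=
  [set [set p.1; p.2] | p in zip c (rot 1 c)].

Definition is_cycle_of (F S : {set {set T}}) : Prop :=
  exists c : seq T, [/\ uniq c, 2 < size c, cycle (adjF F) c & S = cycle_edges c].

Definition cactus (F : {set {set T}}) : Prop :=
  connected_rel (adjF F) /\
  forall f S1 S2, is_cycle_of F S1 -> is_cycle_of F S2 ->
    f \in S1 -> f \in S2 -> S1 = S2.

Definition spanning_cactus (e : rel T) (F : {set {set T}}) : Prop :=
  F \subset Eset e /\ cactus F.

Definition triangles (e : rel T) : {set {set T}} :=
  [set h : {set T} | (#|h| == 3) && [forall x in h, forall y in h, (x != y) ==> e x y]].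

Definition berge_cycle (Eh : {set {set T}}) : Prop :=
  exists n (E : 'I_n -> {set T}) (x : 'I_n -> T),
    [/\ 1 < n, injective E, injective x,
        forall i, E i \in Eh &
        forall i, x i \in E i /\ x i \in E (ordS i)].

Definition berge_acyclic (Eh : {set {set T}}) : Prop := ~ berge_cycle Eh.

Definition hyp_edges (Eh : {set {set T}}) : {set {set T}} :=
  [set [set p.1; p.2] | p in [pred p : T * T |
     (p.1 != p.2) && [exists h in Eh, (p.1 \in h) && (p.2 \in h)]]].

Definition Dset (e : rel T) : {set {set T}} :=
  [set f in Eset e | ~~ [exists h in triangles e, f \subset h]].

Definition Gprime (e : rel T) (Eh : {set {set T}}) : {set {set T}} :=
  hyp_edges Eh :|: Dset e.

Definition grow_step (e : rel T) : rel {set {set T}} :=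
  fun F F' => [exists x : T, exists y : T,
     [&& e x y, ~~ connect (adjF F) x y & F' == [set x; y] |: F]].

End Graphs.

(* Main.v *)
(* Both bounds come from spanning trees.  Removing from [X] one edge of each
   triangle of [E'] leaves a connected graph, so [|X| >= |V| - 1 + |E'|].
   Conversely, let [F0] be a spanning tree of a spanning cactus [F].  The
   fundamental cycles of the edges of [F] outside [F0] are pairwise edge-disjoint,
   and by chordality the vertex set of each contains a triangle of [G].  In a
   cactus, two vertices of a cycle [C] are separated by deleting the edges of [C];
   hence these triangles are distinct and form a Berge-acyclic family, so
   [|F| = |V| - 1 + |F \ F0| <= |V| - 1 + |E'|].
   The graph [X] is a cactus because its cycles are triangles of [E']: a
   growing step creates no cycle, an edge on a cycle of a chordal graph lies in a
   triangle, and in a Berge-acyclic hypergraph two vertices of a hyperedge [h] are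
   separated by deleting [h]. *)
Require Import Defs.
From mathcomp Require Import all_boot.
From mathcomp Require Import zify.
Set Implicit Arguments. Unset Strict Implicit. Unset Printing Implicit Defensive.

(** * Edge sets of cycles, and cycles in a cactus *)

Section Cycles.
Variable T : finType.
Implicit Types (x y z : T) (c p : seq T) (f g : {set T}) (F H S : {set {set T}}).

Lemma set2_eqP x y a b :
  [set x; y] = [set a; b] -> (x = a /\ y = b) \/ (x = b /\ y = a).
Proof.
move=> E.
have := set21 x y; have := set22 x y; have := set21 a b; have := set22 a b.
rewrite {1 2}E -{1 2}E !inE.
by do 4![case/orP=> /eqP ?]; subst; auto.
Qed.

Lemma adjF_sym F : symmetric (adjF F).
Proof. by move=> x y; rewrite /adjF setUC. Qed.

Lemma adjF_connect_sym F : connect_sym (adjF F).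
Proof. exact: sym_connect_sym (adjF_sym F). Qed.

Lemma connect_adjFS F H x y :
  F \subset H -> connect (adjF F) x y -> connect (adjF H) x y.
Proof.
move=> sFH; apply: connect_sub => u v Fuv.
by apply: connect1; apply: (subsetP sFH).
Qed.

Lemma cycle_edgesP c f : uniq c ->
  reflect (exists2 z, z \in c & f = [set z; next c z]) (f \in cycle_edges c).
Proof.
move=> Uc; have Ez x0 : zip c (rot 1 c) = [seq (z, next c z) | z <- c].
  apply: (@eq_from_nth _ (x0, x0)); first by rewrite size_zip size_map size_rot minnn.
  move=> i; rewrite size_zip size_rot minnn => lt_i.
  rewrite nth_zip ?size_rot // (nth_map x0) //; congr (_, _).
  rewrite next_nth mem_nth //.
  case: c Uc lt_i => // x p Uc lt_i; rewrite index_uniq //.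
  (* At the last index [next] wraps around: the default value of [nth] is the head [x], which is
     also what the rotation appends. *)
  rewrite rot1_cons nth_rcons; have [lt_p|le_p] := ltnP i (size p).
    exact: set_nth_default.
  by rewrite nth_default // eqn_leq le_p -ltnS lt_i.
case: c Uc Ez => [|x p] Uc Ez.
  by apply: (iffP imsetP) => [[q]|[z]].
apply: (iffP imsetP) => [[q]|[z zc ->]].
  by rewrite (Ez x) => /mapP[z zc ->] ->; exists z.
by exists (z, next (x :: p) z); rewrite // (Ez x); apply/mapP; exists z.
Qed.

Lemma mem_cycle_edges c z : uniq c -> z \in c -> [set z; next c z] \in cycle_edges c.
Proof. by move=> Uc zc; apply/cycle_edgesP => //; exists z. Qed.

Lemma cycle_cycle_edges c : uniq c -> cycle (adjF (cycle_edges c)) c.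
Proof. by move=> Uc; apply: cycle_from_next => // z; apply: mem_cycle_edges. Qed.

Lemma cycle_edges_sub F c : uniq c ->
  cycle (adjF F) c = (cycle_edges c \subset F).
Proof.
move=> Uc; apply/idP/idP => [Cc|/subsetP sF].
  by apply/subsetP => f /cycle_edgesP-/(_ Uc)[z zc ->]; apply: next_cycle Cc zc.
by apply: cycle_from_next => // z zc; apply: sF; apply: mem_cycle_edges.
Qed.

Lemma next_next_neq c z : uniq c -> 2 < size c -> z \in c -> next c (next c z) != z.
Proof.
move=> Uc sc zc; case: (rot_to zc) => i p Ep.
rewrite -!(next_rot i Uc); move: Uc sc; rewrite -(rot_uniq i) -(size_rot i) Ep.
case: p {Ep} => [|a [|b p]] //=; rewrite !inE !eqxx !negb_or.
by case/andP=> /and3P[za zb _] _ _; rewrite [a == z]eq_sym (negPf za) eq_sym.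
Qed.

(** Two distinct vertices could yield the same edge only by being each other's successor, which a
    length above 2 rules out. *)
Lemma pair_next_inj c : uniq c -> 2 < size c ->
  {in c &, injective (fun z => [set z; next c z])}.
Proof.
move=> Uc sc z w zc wc /= /set2_eqP[[]//|[-> Ew]].
by have := next_next_neq Uc sc wc; rewrite Ew eqxx.
Qed.

Lemma connect_fpath H (n : T -> T) u p :
  fpath n u p -> {in belast u p, forall z, [set z; n z] \in H} ->
  connect (adjF H) u (last u p).
Proof.
elim: p u => [|v p IH] u /=; first by rewrite connect0.
case/andP=> /eqP<- pth Hz; apply: connect_trans (IH _ pth _).
  by apply/connect1/Hz; rewrite inE eqxx.
by move=> z zp; apply: Hz; rewrite inE zp orbT.
Qed.

(* The arc of the cycle leading from the successor of [x] to [y] avoids both edges. *)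
Lemma connect_arc c x y : uniq c -> 2 < size c -> x \in c -> y \in c ->
  connect (adjF (cycle_edges c :\ [set x; next c x] :\ [set y; next c y]))
    (next c x) y.
Proof.
move=> Uc sc xc yc; set u := next c x.
have uc : u \in c by rewrite mem_next.
case: (rot_to uc) => i p Ep.
have En := next_rot i Uc.
have Ur : uniq (u :: p) by rewrite -Ep rot_uniq.
(* Rotating [c] to start at the successor of [x] puts [x] last, so the segment from [u] up to [y]
   never uses the edge leaving [x]. *)
have lastx : last u p = x.
  apply: (can_inj (prev_next Uc)); rewrite -En Ep -/u.
  have := cycle_next Ur; rewrite /= rcons_path => /andP[_ /eqP]//.
have := yc; rewrite -(mem_rot i) Ep => /splitPl Sp.
case: p / Sp Ep Ur lastx => p1 p2 Ly Ep Ur lastx.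
have := cycle_next Ur; rewrite /= -cats1 -catA cat_path => /andP[pth _].
rewrite -Ly; have pth' : fpath (next c) u p1.
  by apply: sub_path pth => a b /=; rewrite -En Ep.
apply: connect_fpath pth' _ => z zb.
have zc : z \in c.
  rewrite -(mem_rot i) Ep -cat_cons mem_cat; apply/orP; left; exact: mem_belast zb.
have nzy : z != y.
  apply: contraTneq zb => ->; move: Ur.
  by rewrite -cat_cons lastI Ly cat_uniq rcons_uniq => /andP[/andP[]].
have nzx : z != x.
  apply: contraTneq zb => zx; move: lastx; rewrite last_cat Ly.
  case: (lastP p2) Ur {Ep pth} => [Ur /= yx|p2' w]; first by rewrite zx yx in nzy; case/eqP: nzy.
  rewrite last_rcons -cat_cons cat_uniq => /and3P[_ /hasPn Un _] wx.
  have := Un x; rewrite wx mem_rcons inE eqxx => /(_ isT) nx.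
  by rewrite zx; apply: contra nx => /mem_belast.
rewrite Ly !inE mem_cycle_edges // andbT; apply/andP; split.
  by apply: contra nzy => /eqP /pair_next_inj->.
by apply: contra nzx => /eqP /pair_next_inj->.
Qed.

(** A simple path from [x] to [y] in [H], closed by the new edge. It has at least three vertices
    because the edge itself is not in [H]. *)
Lemma cycle_through H x y : x != y -> [set x; y] \notin H -> connect (adjF H) x y ->
  exists c, [/\ uniq c, 2 < size c, cycle (adjF ([set x; y] |: H)) c
              & [set x; y] \in cycle_edges c].
Proof.
move=> nxy nH /connectP[p pth Ey].
case/shortenP: pth Ey => q pth Uq _ Ey.
exists (x :: q); split=> //.
- case: q pth Uq Ey nxy => [|a [|b q]] //=; first by move=> _ _ ->; rewrite eqxx.
  by move=> /andP[Hxa _] _ Ey; rewrite Ey in nH; case/negP: nH.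
- rewrite /= rcons_path -Ey {2}/adjF (setUC [set y]) setU11 andbT.
  by apply: sub_path pth => a b; rewrite /adjF inE => ->; rewrite orbT.
apply/cycle_edgesP => //; exists y; first by rewrite Ey mem_last.
have := cycle_next Uq; rewrite /= rcons_path -Ey => /andP[_ /eqP].
by rewrite /= => ->; rewrite setUC.
Qed.

(** A cycle using the added edge would join its ends inside [H] by the rest of the cycle. *)
Lemma grow_cycle H S x y : ~~ connect (adjF H) x y ->
  is_cycle_of ([set x; y] |: H) S -> is_cycle_of H S.
Proof.
move=> nc [c [Uc sc Cc ->]]; exists c; split=> //.
move: Cc; rewrite !cycle_edges_sub // => sF.
suff nf : [set x; y] \notin cycle_edges c.
  apply/subsetP=> f fc; have := subsetP sF f fc.
  by rewrite !inE => /orP[/eqP fxy|//]; rewrite fxy in fc; rewrite fc in nf.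
apply: contra nc => /cycle_edgesP-/(_ Uc)[z zc Ef].
have cz : connect (adjF H) (next c z) z.
  (* With both vertices equal to [z], the arc is the whole cycle minus one edge. *)
  apply: connect_adjFS (connect_arc Uc sc zc zc).
  apply/subsetP => f; rewrite !inE => /and3P[nf _ fc].
  by have := subsetP sF f fc; rewrite !inE Ef (negPf nf).
by case/set2_eqP: Ef => -[-> ->] //; rewrite adjF_connect_sym.
Qed.

(** A path from [x] to [y] off the edges of [c], followed backwards by the arc from the successor of
    [x] to [y], joins the ends of [f] without using [f] or [g]. So [f] lies on a second cycle, one
    that misses the edge [g] of [c]. *)
Lemma cactus_cycle_separates F c x y :
  (forall f S1 S2, is_cycle_of F S1 -> is_cycle_of F S2 ->
    f \in S1 -> f \in S2 -> S1 = S2) ->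
  uniq c -> 2 < size c -> cycle (adjF F) c -> x \in c -> y \in c -> x != y ->
  ~~ connect (adjF (F :\: cycle_edges c)) x y.
Proof.
move=> cacF Uc sc Cc xc yc nxy; apply/negP => cxy.
set f := [set x; next c x]; set g := [set y; next c y].
have fc : f \in cycle_edges c by apply: mem_cycle_edges.
have gc : g \in cycle_edges c by apply: mem_cycle_edges.
have sF : cycle_edges c \subset F by rewrite -cycle_edges_sub.
have nfg : f != g by apply: contra nxy => /eqP /pair_next_inj->.
set H := F :\ f :\ g.
have cH : connect (adjF H) x (next c x).
  rewrite adjF_connect_sym; apply: (@connect_trans _ _ y).
    by apply: connect_adjFS (connect_arc Uc sc xc yc); rewrite !setSD.
  rewrite adjF_connect_sym; apply: connect_adjFS cxy.
  apply/subsetP => h; rewrite !inE => /andP[nh ->]; rewrite andbT.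
  by apply/andP; split; apply: contraNneq nh => ->.
have nxn : x != next c x.
  apply: contraTneq (next_next_neq Uc sc xc) => E.
  by rewrite -!E eqxx.
have nfH : f \notin H by rewrite !inE eqxx andbF.
case: (cycle_through nxn nfH cH) => d [Ud sd Cd fd].
have sfH : f |: H \subset F.
  by rewrite subUset sub1set (subsetP sF) // /H (subset_trans (subsetDl _ _)) // subsetDl.
have Ed : cycle_edges d = cycle_edges c.
  apply: (cacF f) => //; last by exists c.
  by exists d; split=> //; move: Cd; rewrite !cycle_edges_sub // => /subset_trans->.
move: Cd; rewrite cycle_edges_sub // Ed => /subsetP /(_ g gc).
by rewrite !inE eqxx orbF eq_sym (negPf nfg).
Qed.

End Cycles.

(** * Spanning trees, and triangles in chordal graphs *)

Section TreesAndChords.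
Variable T : finType.
Implicit Types (x y z : T) (c p : seq T) (f g : {set T}) (F H S : {set {set T}}).

Lemma connect_crossing (r : rel T) (A : {set T}) x y :
  connect r x y -> x \in A -> y \notin A ->
  exists u v, [/\ u \in A, v \notin A & r u v].
Proof.
case/connectP=> p; elim: p x => [|z p IH] x /=; first by move=> _ -> ->.
case/andP=> rxz pth Ey xA yA; have [zA|zA] := boolP (z \in A).
  exact: IH pth Ey zA yA.
by exists x, z.
Qed.

(** The tree is described by connectedness and its edge count, and is grown from [x0] by one
    crossing edge at a time. *)
Lemma spanning_tree F (x0 : T) : connected_rel (adjF F) ->
  exists F0, [/\ F0 \subset F, #|F0|.+1 = #|T| & connected_rel (adjF F0)].
Proof.
move=> conF.
(* [A] is the set of vertices reached after [k] edges. Keeping all edges of [F0] inside [A]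
   guarantees that the next crossing edge is new. *)
have grow k : k < #|T| -> exists (A : {set T}) F0,
    [/\ x0 \in A, #|A| = k.+1, #|F0| = k & F0 \subset F] /\
    ({in F0, forall f, f \subset A} /\ {in A, forall x, connect (adjF F0) x0 x}).
  elim: k => [|k IH] ltk.
    exists [set x0], set0; split; first by rewrite set11 cards1 cards0 sub0set.
    by split=> [f|x]; rewrite inE // => /eqP->; exact: connect0.
  have [A [F0 [[x0A cA cF0 sF0] [F0A conA]]]] := IH (ltnW ltk).
  have /subsetPn[z _ zA] : ~~ ([set: T] \subset A).
    by apply: contraTN ltk => /subset_leq_card; rewrite cardsT cA -leqNgt.
  have [u [v [uA vA Fuv]]] := connect_crossing (conF x0 z) x0A zA.
  have nF : [set u; v] \notin F0.
    by apply: contra vA => /F0A /subsetP; apply; rewrite set22.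
  exists (v |: A), ([set u; v] |: F0); split.
    rewrite inE x0A orbT !cardsU1 vA nF cA cF0; split=> //.
    by rewrite subUset sub1set sF0 andbT.
  split=> [f|x]; rewrite !inE.
    case/orP=> [/eqP->|/F0A sfA]; last exact: subset_trans sfA (subsetUr _ _).
    by apply/subsetP=> w; rewrite !inE => /orP[]/eqP->; rewrite ?uA ?eqxx ?orbT.
  have sub y : y \in A -> connect (adjF ([set u; v] |: F0)) x0 y.
    by move/conA; apply: connect_adjFS; rewrite subsetUr.
  case/orP=> [/eqP->|]; last exact: sub.
  by apply: connect_trans (sub u uA) (connect1 _); rewrite /adjF setU11.
have T0 : 0 < #|T| by apply/card_gt0P; exists x0.
have [|A [F0 [[x0A cA cF0 sF0] [_ conA]]]] := grow #|T|.-1; first by rewrite prednK.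
exists F0; split; rewrite ?cF0 ?prednK //.
have AT x : x \in A.
  have /subset_leqif_cards[_] := subsetT A.
  by rewrite cA cardsT prednK // eqxx => /esym/eqP->; rewrite inE.
by move=> x y; apply: (@connect_trans _ _ x0); rewrite ?conA // adjF_connect_sym conA.
Qed.

(** Induction on the length: a cycle longer than a triangle has a chord, and the side of the chord
    containing the edge [x y] is a shorter cycle whose other vertices still come from [p]. *)
Lemma chord_triangle (e : rel T) x y p :
  symmetric e -> irreflexive e -> chordal e ->
  uniq [:: x, y & p] -> p != [::] -> cycle e [:: x, y & p] ->
  exists2 z, z \in p & e x z && e y z.
Proof.
move=> e_sym e_irr e_ch; have [n] := ubnP (size p); elim: n => // n IH in p *.
rewrite ltnS => lepn Uc p0 Cc.
have [p1|p1] := leqP (size p) 1.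
  case: p p0 p1 Cc {Uc lepn IH} => [|z [|]] //= _ _.
  by case/and4P=> _ eyz ezx _; exists z; rewrite ?inE // e_sym ezx.
have shorter q : size q < size p -> subseq q p -> q != [::] ->
    cycle e [:: x, y & q] -> exists2 z, z \in p & e x z && e y z.
  move=> ltq sqp q0 Cq; have Uq : uniq [:: x, y & q].
    by apply: subseq_uniq Uc; rewrite /= !eqxx.
  have [z zq ezz] := IH q (leq_trans ltq lepn) Uq q0 Cq.
  by exists z; rewrite ?(mem_subseq sqp).
set c := [:: x, y & p] in Uc Cc.
have chord i j : i < j < size c -> j != i.+1 -> ~~ ((i == 0) && (j.+1 == size c)) ->
    e (nth x c i) (nth x c j) -> exists2 z, z \in p & e x z && e y z.
  case/andP=> ltij ltj nij nend eij.
  case: j ltij ltj nij nend eij => [|[|l]] //=; first by case: i.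
  rewrite !ltnS => leil ltl nil nend eij.
  have Ep : p = take l p ++ nth x p l :: drop l.+1 p by rewrite -drop_nth // cat_take_drop.
  move: Cc; rewrite /c /= {1}Ep; case/andP=> exy.
  rewrite rcons_cat cat_path /= rcons_path => /and4P[pth1 elw pth2 ewx].
  (* A chord at [x] lets everything after the [l]-th vertex of [p] be dropped; any other chord lets
     the vertices strictly between its ends be dropped. The edge [x y] survives in both cases. *)
  case: i leil nil nend eij => [|k] /= leil nil nend eij.
    apply: (shorter (rcons (take l p) (nth x p l))).
    - rewrite size_rcons size_take ltl ltn_neqAle ltl andbT.
      by apply: contra nend => /eqP->.
    - by rewrite [X in subseq _ X]Ep -cats1 cat_subseq // sub1seq inE eqxx.
    - by case: (take l p).
    by rewrite /= exy !rcons_path last_rcons pth1 elw /= e_sym.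
  have ltkl : k < l by lia.
  apply: (shorter (take k p ++ nth x p l :: drop l.+1 p)).
  - rewrite size_cat /= size_drop size_take (ltn_trans ltkl ltl); lia.
  - rewrite [X in subseq _ X]Ep cat_subseq // -(cat_take_drop k (take l p)) take_takel ?(ltnW ltkl) //.
    exact: prefix_subseq.
  - by case: (take k p).
  rewrite /= exy rcons_cat cat_path /= rcons_path pth2 ewx !andbT.
  move: pth1; rewrite -(cat_take_drop k (take l p)) take_takel ?(ltnW ltkl) // cat_path => /andP[-> _] /=.
  suff -> : last y (take k p) = nth x (y :: p) k by [].
  case: k {eij nil nend leil} ltkl => [|k] ltkl; first by rewrite take0.
  have ltk : k < size p by lia.
  by rewrite (take_nth x) // last_rcons.
have [/existsP[i /existsP[j /and4P[ltij nij nend eij]]]|noch] :=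
    boolP [exists i : 'I_(size c), exists j : 'I_(size c),
       [&& i < j, j != i.+1 :> nat, ~~ ((i == 0 :> nat) && (j.+1 == size c))
         & e (nth x c i) (nth x c j)]].
  by apply: (chord i j) => //; rewrite ltij ltn_ord.
(* Otherwise [c] itself contradicts chordality. What remains is to order the two indices and to
   match the wrap-around pair, first and last, with the condition modulo the length. *)
case: e_ch; exists c; split=> // i j li lj z0.
rewrite !(set_nth_default x z0) // => eij.
apply: contraNT noch; rewrite negb_or => /andP[nij nji].
have wlog i' j' : i' < j' -> i' < size c -> j' < size c -> j' != i'.+1 %% size c ->
     i' != j'.+1 %% size c -> e (nth x c i') (nth x c j') ->
    [exists i : 'I_(size c), exists j : 'I_(size c),
       [&& i < j, j != i.+1 :> nat, ~~ ((i == 0 :> nat) && (j.+1 == size c))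
         & e (nth x c i) (nth x c j)]].
  move=> ltij li' lj' nij' nji' eij'.
  apply/existsP; exists (Ordinal li'); apply/existsP; exists (Ordinal lj').
  rewrite /= ltij eij' andbT /=; apply/andP; split.
    by apply: contra nij' => /eqP E; rewrite -E modn_small.
  by apply: contra nji' => /andP[/eqP-> /eqP->]; rewrite modnn.
have [ltij|ltji|Eij] := ltngtP i j; first exact: (wlog i j).
  by apply: (wlog j i); rewrite // e_sym.
by rewrite Eij e_irr in eij.
Qed.

(** After rotation the given edge comes first and [chord_triangle] applies. The inclusion of the
    triangle in [c] serves the counting of cactus edges. *)
Lemma cycle_edge_triangle (e : rel T) c z :
  symmetric e -> irreflexive e -> chordal e ->
  uniq c -> 2 < size c -> cycle e c -> z \in c ->
  exists2 t, t \in triangles e & ([set z; next c z] \subset t) && (t \subset c).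
Proof.
move=> e_sym e_irr e_ch Uc sc Cc zc; case: (rot_to zc) => i q Eq.
have Ur : uniq (z :: q) by rewrite -Eq rot_uniq.
have Cr : cycle e (z :: q) by rewrite -Eq rot_cycle.
have mr : rot i c =i c by apply: mem_rot.
move: sc mr; rewrite -(next_rot i Uc) -(size_rot i) Eq.
case: q {Eq} Ur Cr => [|y [|a p]] // Ur Cr _ mr.
have /= [w wp /andP[ezw eyw]] := chord_triangle e_sym e_irr e_ch Ur isT Cr.
have ezy : e z y by case/andP: Cr.
rewrite eqxx; exists [set z; y; w].
  rewrite inE; apply/andP; split.
    have nzy : z != y by apply: contraTneq ezy => ->; rewrite e_irr.
    have nzw : z != w by apply: contraTneq ezw => ->; rewrite e_irr.
    have nyw : y != w by apply: contraTneq eyw => ->; rewrite e_irr.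
    by rewrite setUC cardsU1 cards2 nzy !inE negb_or ![w == _]eq_sym nzw nyw.
  apply/forall_inP => a1 + ; rewrite !inE => a1P; apply/forall_inP => a2.
  rewrite !inE => a2P; apply/implyP.
  by move: a1P a2P; do 2!(case/orP=> [/orP[]|] /eqP->); rewrite ?eqxx // e_sym.
rewrite subsetUl /=; apply/subsetP=> v; rewrite -mr !inE.
by case/orP=> [/orP[]|] /eqP->; rewrite ?eqxx ?orbT //; move: wp; rewrite inE => ->; rewrite !orbT.
Qed.

End TreesAndChords.

(** * Berge-acyclic hypergraphs and the cycles of their graphs *)

Section Berge.
Variable T : finType.
Implicit Types (x y z : T) (c p : seq T) (f g h : {set T}) (F H S A : {set {set T}}).

Lemma adjF_hyp_edges A x y :
  adjF (hyp_edges A) x y = (x != y) && [exists h in A, (x \in h) && (y \in h)].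
Proof.
apply/imsetP/idP => [[[a b] /= + /set2_eqP E]|xy]; last by exists (x, y).
rewrite inE /=; case: E => -[-> ->] //.
rewrite eq_sym; under eq_existsb => h do rewrite (andbC (a \in h)).
by [].
Qed.

Lemma hyp_edges_pair A h x y :
  h \in A -> x != y -> x \in h -> y \in h -> [set x; y] \in hyp_edges A.
Proof.
move=> Ah nxy xh yh; rewrite -[_ \in _]/(adjF _ _ _) adjF_hyp_edges nxy /=.
by apply/existsP; exists h; rewrite Ah xh.
Qed.

(** A walk in the hypergraph: each entry of [q] is a hyperedge together with the vertex at which the
    walk leaves it. *)
Fixpoint berge_path A x (q : seq ({set T} * T)) : bool :=
  if q is (h, v) :: q' then [&& h \in A, x \in h, v \in h & berge_path A v q']
  else true.

Lemma berge_path_cat A x q1 q2 :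
  berge_path A x (q1 ++ q2) =
  berge_path A x q1 && berge_path A (last x (map snd q1)) q2.
Proof. by elim: q1 x => [|[h v] q1 IH] x //=; rewrite IH !andbA. Qed.

(** Repetitions are cut out from the front: if [x] is met again, the walk restarts there; if [h] is
    used again, the walk passes at once from [x] to the later exit of [h]. *)
Lemma berge_path_uniq A x p : path (adjF (hyp_edges A)) x p ->
  exists q, [/\ berge_path A x q, last x (map snd q) = last x p,
                uniq (x :: map snd q) & uniq (map fst q)].
Proof.
elim: p x => [|y p IH] x /=; first by exists [::].
case/andP; rewrite adjF_hyp_edges => /andP[nxy /existsP[h /and3P[Ah xh yh]]].
case/IH=> q [bq <- Uv Uh].
have [xq|xq] := boolP (x \in map snd q).
  case/mapP: xq => -[h' x'] /= xq Ex; subst x'.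
  case/splitPr: xq bq Uv Uh => q1 q2.
  rewrite -cat_rcons berge_path_cat !map_cat map_rcons last_rcons last_cat last_rcons /=.
  case/andP=> _ bq /andP[_]; rewrite cat_uniq rcons_uniq => /and3P[_ nq U2].
  rewrite map_rcons cat_uniq => /and3P[_ _ Uh2].
  exists q2; split=> //=; rewrite U2 andbT; apply: contra nq => xq2.
  by apply/hasP; exists x; rewrite // mem_rcons inE eqxx.
have [hq|hq] := boolP (h \in map fst q).
  case/mapP: hq => -[h' v] /= hq Eh; subst h'.
  case/splitPr: hq xq bq Uv Uh => q1 q2.
  rewrite berge_path_cat !map_cat /= => xq /andP[_ /and4P[_ _ vh bq]] /andP[_].
  rewrite !cat_uniq => /and3P[_ _ Uv] /and3P[_ _ Uh].
  exists ((h, v) :: q2); split; rewrite ?last_cat //=; first by rewrite Ah xh vh.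
  move: Uv => /= ->; rewrite andbT; apply: contra xq; rewrite mem_cat => ->.
  by rewrite orbT.
exists ((h, y) :: q); split=> //=; first by rewrite Ah xh yh.
  by rewrite inE negb_or nxy xq.
by rewrite hq.
Qed.

Lemma berge_path_nth A x q h0 i : berge_path A x q -> i < size q ->
  [/\ nth h0 (map fst q) i \in A, nth x (x :: map snd q) i \in nth h0 (map fst q) i
    & nth x (map snd q) i \in nth h0 (map fst q) i].
Proof.
elim: q x i => [|[h v] q IH] x [|i] //= /and4P[Ah xh vh bq] lti //.
have [? Hv Hi] := IH v i bq lti; split=> //.
  by move: Hv; rewrite (set_nth_default x) //= size_map ltnW.
by move: Hi; rewrite (set_nth_default x) // size_map.
Qed.

(** A connection avoiding [h] shortens to a walk with distinct vertices and distinct hyperedges,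
    which [h] closes to a Berge-cycle. *)
Lemma berge_acyclic_separates A h x y :
  berge_acyclic A -> h \in A -> x \in h -> y \in h -> x != y ->
  ~~ connect (adjF (hyp_edges (A :\ h))) x y.
Proof.
move=> acA Ah xh yh nxy; apply/negP => /connectP[p pth Ey]; apply: acA.
have [q [bq lq Uv Uh]] := berge_path_uniq pth; rewrite -{}Ey in lq.
have nq i : i < size q -> _ := berge_path_nth h bq.
have hq : h \notin map fst q.
  apply/negP=> /(nthP h)[i]; rewrite size_map => lti Eh.
  by have [] := nq i lti; rewrite Eh !inE eqxx.
(* The cycle starts with [h] and [x]; its last vertex is [y], which lies in [h] and so closes it
   up. *)
exists (size q).+1, (fun i : 'I_(size q).+1 => nth h (h :: map fst q) i),
  (fun i : 'I_(size q).+1 => nth x (x :: map snd q) i).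
have inj (R : eqType) (r0 : R) s : uniq s -> size s = (size q).+1 ->
    injective (fun i : 'I_(size q).+1 => nth r0 s i).
  by move=> Us ss i j /eqP; rewrite nth_uniq ?ss // => /eqP/val_inj.
split.
- by case: q lq {bq nq Uv Uh hq inj} nxy => //= ->; rewrite eqxx.
- by apply: inj; rewrite /= ?hq ?size_map.
- by apply: inj; rewrite //= ?size_map.
- by case=> [[|i] lti] //=; have [] := nq i lti; rewrite inE => /andP[].
case=> i lti /=; split.
  by case: i lti => [|i] lti //=; have [] := nq i lti.
have [ltq|] := ltnP i (size q); first by rewrite modn_small ?ltnS //=; have [] := nq i ltq.
rewrite ltnS in lti; move=> leq; have -> : i = size q by apply/eqP; rewrite eqn_leq lti.
by rewrite modnn /= -(size_map snd) (nth_last x (x :: _)) /= lq.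
Qed.

Lemma berge_acyclic_linear A h1 h2 x y :
  berge_acyclic A -> h1 \in A -> h2 \in A -> x != y ->
  x \in h1 -> y \in h1 -> x \in h2 -> y \in h2 -> h1 = h2.
Proof.
move=> acA A1 A2 nxy x1 y1 x2 y2; apply/eqP; apply: contraNT (berge_acyclic_separates acA A1 x1 y1 nxy).
move=> n12; apply: connect1; apply: (@hyp_edges_pair _ h2) => //.
by rewrite !inE A2 eq_sym n12.
Qed.

(** [u] is the last vertex of [h] on the path: each later edge has an end outside [h], hence stems
    from another hyperedge. *)
Lemma last_exit A h x p :
  path (adjF (hyp_edges A)) x p -> x \in h -> last x p \notin h ->
  exists2 u, u \in x :: p & (u \in h) && connect (adjF (hyp_edges (A :\ h))) u (last x p).
Proof.
elim/last_ind: p => [|p z IH]; first by move=> _ /= ->.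
rewrite rcons_path last_rcons => /andP[pth Auz] xh zh.
have uz : adjF (hyp_edges (A :\ h)) (last x p) z.
  move: Auz; rewrite !adjF_hyp_edges => /andP[->] /existsP[g /and3P[Ag lg zg]].
  apply/existsP; exists g; rewrite !inE Ag lg zg !andbT.
  by apply: contraNneq zh => <-.
rewrite -rcons_cons; have [lh|lh] := boolP (last x p \in h).
  exists (last x p); first by rewrite mem_rcons inE mem_last orbT.
  by rewrite lh connect1.
have [u up /andP[uh cu]] := IH pth xh lh.
exists u; first by rewrite mem_rcons inE up orbT.
by rewrite uh (connect_trans cu) // connect1.
Qed.

(** From a vertex [w] outside [h], following [c] in the two directions until it first meets [h]
    gives two distinct vertices of [h] connected through [w] without [h], against
    [berge_acyclic_separates]. *)
Lemma hyp_cycle_within A c z h : berge_acyclic A -> uniq c -> 2 < size c ->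
  cycle (adjF (hyp_edges A)) c -> z \in c -> h \in A ->
  z \in h -> next c z \in h -> {subset c <= h}.
Proof.
move=> acA Uc sc Cc zc Ah zh nzh w wc; apply: contraT => wh.
set x := next c z in nzh.
have xc : x \in c by rewrite mem_next.
case: (rot_to xc) => i p Ep.
have Ur : uniq (x :: p) by rewrite -Ep rot_uniq.
have Cr : cycle (adjF (hyp_edges A)) (x :: p) by rewrite -Ep rot_cycle.
have lastz : last x p = z.
  apply: (can_inj (prev_next Uc)); rewrite -(next_rot i Uc) Ep -/x.
  by have := cycle_next Ur; rewrite /= rcons_path => /andP[_ /eqP].
have wp : w \in p.
  move: wc; rewrite -(mem_rot i) Ep inE => /orP[/eqP wx|//].
  by rewrite wx nzh in wh.
move: Cr; rewrite /= rcons_path => /andP[pth _].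
case/splitPr: wp Ur pth lastz {Ep} => p1 p2 Ur pth lastz.
have [u up /andP[uh cu]] : exists2 u, u \in x :: p1 & (u \in h) && connect (adjF (hyp_edges (A :\ h))) u w.
  move: pth; rewrite -cat_rcons cat_path => /andP[pth _].
  have := last_exit pth nzh; rewrite last_rcons => /(_ wh)[u + uP].
  rewrite -rcons_cons mem_rcons inE => /orP[/eqP uw|up]; last by exists u.
  by move: uP; rewrite uw (negPf wh).
(* The second arc is traversed backwards, from [z] to [w]. *)
have [v vp /andP[vh cv]] : exists2 v, v \in p2 & (v \in h) && connect (adjF (hyp_edges (A :\ h))) v w.
  move: pth; rewrite cat_path /= => /and3P[_ _ pth].
  move: lastz; rewrite last_cat /= => lastz.
  have := rev_path (adjF (hyp_edges A)) w p2; rewrite lastz.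
  rewrite -(eq_path (adjF_sym _)) pth => rpth; have := last_exit rpth zh.
  have -> : last z (rev (belast w p2)) = w.
    by rewrite -lastz; case: (p2) => //= a s; rewrite rev_cons last_rcons.
  case/(_ wh)=> v + vP; rewrite -lastz -rev_rcons -lastI mem_rev inE => /orP[/eqP vw|vp].
    by move: vP; rewrite vw (negPf wh).
  by exists v.
have nuv : u != v.
  apply: contraTneq vp => <-; move: Ur; rewrite -cat_cons cat_uniq => /and3P[_ /hasPn nU _].
  by apply: contraL up => up2; apply: nU; rewrite inE up2 orbT.
case/negP: (berge_acyclic_separates acA Ah uh vh nuv).
by apply: connect_trans cu _; rewrite adjF_connect_sym.
Qed.

(** The cycle stays within one triangle, and equality follows by counting: a triangle has at most 3
    edges, a cycle at least 3. *)
Lemma hyp_cycle_edges A S (e : rel T) : A \subset triangles e -> berge_acyclic A ->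
  is_cycle_of (hyp_edges A) S ->
  exists2 h, h \in A & S = hyp_edges [set h].
Proof.
move=> /subsetP sA acA [c [Uc sc Cc ->]].
have [x xc] : exists x, x \in c by case: (c) sc => // x p _; exists x; rewrite inE eqxx.
have := next_cycle Cc xc; rewrite adjF_hyp_edges => /andP[_ /existsP[h /and3P[Ah xh nxh]]].
have sub := hyp_cycle_within acA Uc sc Cc xc Ah xh nxh.
exists h => //.
have ch : #|h| = 3 by have := sA h Ah; rewrite inE => /andP[/eqP].
have sub1 : cycle_edges c \subset hyp_edges [set h].
  apply/subsetP => f /cycle_edgesP-/(_ Uc)[z zc ->].
  have := next_cycle Cc zc; rewrite adjF_hyp_edges => /andP[nz _].
  by apply: (@hyp_edges_pair _ h); rewrite ?set11 // sub ?mem_next.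
apply/eqP; rewrite eqEcard sub1 /=.
have le3 : #|hyp_edges [set h]| <= 3.
  have -> : 3 = #|[set B : {set T} | B \subset h & #|B| == 2]| by rewrite cards_draws ch.
  apply: subset_leq_card; apply/subsetP => f /imsetP[[a b]]; rewrite !inE /=.
  case/andP=> nab /existsP[h' /and3P[]]; rewrite inE => /eqP-> ah bh ->.
  by rewrite subUset !sub1set ah bh cards2 nab.
apply: leq_trans (leq_trans le3 sc) _.
have -> : cycle_edges c = [set [set z; next c z] | z in c].
  by apply/setP=> f; apply/cycle_edgesP/imsetP => // -[z zc ->]; exists z.
by rewrite card_in_imset ?(card_uniqP Uc) //; apply: pair_next_inj.
Qed.

End Berge.

(** * Growing steps and the two bounds on the number of edges *)

Section Counting.
Variables (T : finType) (e : rel T).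
Hypotheses (e_sym : symmetric e) (e_irr : irreflexive e) (e_ch : chordal e).
Implicit Types (x y z : T) (c p : seq T) (f g h : {set T}) (F H S A : {set {set T}}).

Lemma adjF_Eset x y : adjF (Eset e) x y = e x y.
Proof.
apply/imsetP/idP => [[[a b]]|exy]; last by exists (x, y).
by rewrite inE /= => eab /set2_eqP[[-> ->]|[-> ->]] //; rewrite e_sym.
Qed.

Lemma cycle_adjFS F c : F \subset Eset e -> cycle (adjF F) c -> cycle e c.
Proof.
move=> /subsetP sF; apply: sub_cycle => x y Fxy.
by rewrite -adjF_Eset; apply: sF.
Qed.

Lemma card_triangle h : h \in triangles e -> #|h| = 3.
Proof. by rewrite inE => /andP[/eqP]. Qed.

Lemma triangle_edge h x y : h \in triangles e -> x \in h -> y \in h -> x != y -> e x y.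
Proof. by rewrite inE => /andP[_ /forall_inP/(_ x) + xh yh nxy] => /(_ xh)/forall_inP/(_ y yh)/implyP->. Qed.

Lemma hyp_edges_Eset A : A \subset triangles e -> hyp_edges A \subset Eset e.
Proof.
move=> /subsetP sA; apply/subsetP => f /imsetP[[x y]]; rewrite inE /=.
case/andP=> nxy /existsP[h /and3P[/sA Ah xh yh]] ->.
by rewrite -[_ \in _]/(adjF _ _ _) adjF_Eset (triangle_edge Ah).
Qed.

Lemma Gprime_Eset A : A \subset triangles e -> Gprime e A \subset Eset e.
Proof.
move=> sA; rewrite subUset hyp_edges_Eset //=.
by apply/subsetP => f; rewrite inE => /andP[].
Qed.

Lemma grow_steps_invariant F H : connect (grow_step e) F H -> F \subset Eset e ->
  [/\ F \subset H, H \subset Eset e & forall S, is_cycle_of H S -> is_cycle_of F S].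
Proof.
case/connectP=> p + ->; elim: p F => [|H1 p IH] F /=; first by split.
case/andP=> /existsP[x /existsP[y /and3P[exy ncxy /eqP E1]]] pth sF.
have sH1 : H1 \subset Eset e.
  by rewrite E1 subUset sub1set sF andbT -[_ \in _]/(adjF _ _ _) adjF_Eset.
have [s1 s2 cyc] := IH _ pth sH1; split=> //.
  by apply: subset_trans s1; rewrite E1 subsetUr.
by move=> S /cyc; rewrite E1; apply: grow_cycle.
Qed.

(** No edge of [Dset e] lies on a cycle, since chordality would put it in a triangle; so the cycle
    uses only edges of hyperedges in [A]. *)
Lemma Gprime_cycle A S : A \subset triangles e -> berge_acyclic A ->
  is_cycle_of (Gprime e A) S -> exists2 h, h \in A & S = hyp_edges [set h].
Proof.
move=> sA acA [c [Uc sc Cc ES]]; apply: hyp_cycle_edges (sA) acA _.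
exists c; split=> //; have Ce := cycle_adjFS (Gprime_Eset sA) Cc.
move: Cc; rewrite !cycle_edges_sub // => /subsetP sG; apply/subsetP => f fc.
have := sG f fc; rewrite inE => /orP[//|]; rewrite inE => /andP[_ /existsP[]].
case/cycle_edgesP: fc => // z zc ->.
have [t tri /andP[st _]] := cycle_edge_triangle e_sym e_irr e_ch Uc sc Ce zc.
by exists t; rewrite tri.
Qed.

Lemma card_linear_triangles A F (x0 : T) :
  A \subset triangles e -> berge_acyclic A -> hyp_edges A \subset F ->
  connected_rel (adjF F) -> #|T| + #|A| <= #|F|.+1.
Proof.
move=> /subsetP sA acA sF conF.
have /fin_all_exists[d dP] h : exists q : T * T,
    h \in A -> [/\ q.1 != q.2, q.1 \in h & q.2 \in h].
  have [Ah|_] := boolP (h \in A); last by exists (x0, x0).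
  have ch := card_triangle (sA h Ah).
  have /card_gt1P[x [y [xh yh nxy]]] : 1 < #|h| by rewrite ch.
  by exists (x, y).
pose D h := [set (d h).1; (d h).2].
(* The edge [D h] chosen for removal lies in no member of [A] other than [h], so each triangle loses
   exactly one edge. *)
have D_uniq h h' x y : h \in A -> h' \in A -> x != y -> x \in h' -> y \in h' ->
    [set x; y] = D h -> h' = h.
  move=> Ah Ah' nxy xh yh /set2_eqP E; have [_ d1 d2] := dP h Ah.
  by apply: (berge_acyclic_linear acA Ah' Ah nxy xh yh); case: E => -[Ex Ey]; rewrite ?Ex ?Ey.
have D_inj : {in A &, injective D}.
  move=> h h' Ah Ah' E; have [n1 d1 d2] := dP h Ah.
  exact: (D_uniq h' h _ _ Ah' Ah n1 d1 d2).
pose R := [set D h | h in A].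
have sRF : R \subset F.
  apply/subsetP=> f /imsetP[h Ah ->]; have [n1 d1 d2] := dP h Ah.
  by apply: (subsetP sF); apply: hyp_edges_pair Ah n1 d1 d2.
have conFR : connected_rel (adjF (F :\: R)).
  move=> x y; apply: connect_sub (conF x y) => u v Fuv.
  have [fR|fR] := boolP ([set u; v] \in R); last first.
    by apply: connect1; rewrite /adjF inE fR.
  case/imsetP: (fR) => h Ah Euv; have [n1 d1 d2] := dP h Ah.
  have [nuv uh vh] : [/\ u != v, u \in h & v \in h].
    by case: (set2_eqP Euv) => -[-> ->]; rewrite // eq_sym.
  (* A removed edge is bypassed through the third vertex [w] of its triangle, whose two edges at [w]
     survive. *)
  have /subsetPn[w wh] : ~~ (h \subset [set u; v]).
    apply: contraTN isT => /subset_leq_card.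
    by rewrite cards2 nuv (card_triangle (sA h Ah)).
  rewrite !inE negb_or => /andP[nwu nwv].
  have keep z : z \in h -> w != z -> z \in [set u; v] -> adjF (F :\: R) w z.
    move=> zh nwz zuv; rewrite /adjF inE.
    have -> : [set w; z] \in F.
      by apply: (subsetP sF); apply: hyp_edges_pair Ah nwz wh zh.
    rewrite andbT; apply/negP => /imsetP[h' Ah' Ewz].
    have Eh := D_uniq h' h w z Ah' Ah nwz wh zh Ewz; subst h'.
    have : w \in [set u; v] by rewrite Euv /D -/(D h) -Ewz set21.
    by rewrite !inE (negPf nwu) (negPf nwv).
  apply: (@connect_trans _ _ w); last by apply/connect1/keep; rewrite ?set22.
  by rewrite adjF_connect_sym; apply/connect1/keep; rewrite ?set21.
have [F0 [sF0 cF0 _]] := spanning_tree x0 conFR.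
have cR : #|R| = #|A| by apply: card_in_imset.
have leA : #|A| <= #|F| by rewrite -cR subset_leq_card.
rewrite -cF0 addSn ltnS addnC -leq_subRL // -cR -{1}(setIidPr sRF) -cardsD.
exact: subset_leq_card.
Qed.

Lemma card_cactus_triangles F (x0 : T) : spanning_cactus e F ->
  exists A, [/\ A \subset triangles e, berge_acyclic A & #|F|.+1 = #|T| + #|A|].
Proof.
case=> sFE [conF cacF].
have [F0 [sF0 cF0 conF0]] := spanning_tree x0 conF.
pose K := F :\: F0.
(* Each edge outside the tree receives its fundamental cycle and a triangle of the graph on vertices
   of that cycle; edges outside [K] get a dummy pair. *)
have /fin_all_exists[ct ctP] f : exists q : seq T * {set T}, f \in K ->
    [/\ [/\ uniq q.1, 2 < size q.1, cycle (adjF F) q.1 & cycle_edges q.1 \subset f |: F0],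
      f \in cycle_edges q.1, q.2 \in triangles e & q.2 \subset q.1].
  have [|_] := boolP (f \in K); last by exists ([::], set0).
  rewrite inE => /andP[nf fF]; have /imsetP[[x y]] := subsetP sFE f fF.
  rewrite inE /= => exy Ef.
  have nxy : x != y by apply: contraTneq exy => ->; rewrite e_irr.
  have [||c [Uc sc Cc fc]] := @cycle_through _ F0 x y nxy; rewrite -?Ef //.
  have s1 : cycle_edges c \subset f |: F0 by rewrite Ef -cycle_edges_sub.
  have s2 : f |: F0 \subset F by rewrite subUset sub1set fF.
  have CF : cycle (adjF F) c by rewrite cycle_edges_sub // (subset_trans s1).
  have /cycle_edgesP-/(_ Uc)[z zc _] := fc.
  have [t tri /andP[_ stc]] :=
    cycle_edge_triangle e_sym e_irr e_ch Uc sc (cycle_adjFS sFE CF) zc.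
  by exists (c, t) => _; split=> //=; rewrite Ef.
pose C f := (ct f).1; pose t f := (ct f).2.
(* If two fundamental cycles shared an edge, they would coincide in the cactus, and [g] would be a
   second non-tree edge on the cycle of [f]. *)
have disj f g : f \in K -> g \in K -> f != g ->
    cycle_edges (C g) \subset F :\: cycle_edges (C f).
  move=> Kf Kg nfg.
  have [[Uf sf Cf sub_f] ff _ _] := ctP f Kf; have [[Ug sg Cg _] gg _ _] := ctP g Kg.
  apply/subsetP => h hg; rewrite inE.
  have -> : h \in F by apply: (subsetP _ h hg); rewrite -cycle_edges_sub.
  rewrite andbT; apply/negP => hf.
  have E : cycle_edges (C f) = cycle_edges (C g).
    by apply: (cacF h); rewrite //; [exists (C f) | exists (C g)].
  have : g \in f |: F0 by apply: (subsetP sub_f); rewrite -/(C f) E.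
  move: Kg; rewrite !inE eq_sym (negPf nfg) /= => /andP[/negPf-> _].
  by [].
have conC f g x y : f \in K -> g \in K -> f != g -> x \in t g -> y \in t g ->
    connect (adjF (F :\: cycle_edges (C f))) x y.
  move=> Kf Kg nfg /= xt yt; have [[Ug sg Cg _] _ _ stg] := ctP g Kg.
  apply: connect_adjFS (disj f g Kf Kg nfg) _.
  by apply: (connect_cycle (cycle_cycle_edges Ug)); apply: (subsetP stg).
have sep f x y : f \in K -> x \in t f -> y \in t f -> x != y ->
    ~~ connect (adjF (F :\: cycle_edges (C f))) x y.
  move=> Kf xt yt nxy; have [[Uf sf Cf _] _ _ stf] := ctP f Kf.
  by apply: cactus_cycle_separates => //; apply: (subsetP stf).
have t_inj : {in K &, injective t}.
  move=> f g Kf Kg Etfg; apply/eqP; apply: contraT => nfg.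
  have [_ _ tri _] := ctP f Kf.
  have /card_gt1P[x [y [xt yt nxy]]] : 1 < #|t f| by rewrite (card_triangle tri).
  by case/negP: (sep f x y Kf xt yt nxy); apply: conC nfg _ _; rewrite // -Etfg.
exists [set t f | f in K]; split.
- by apply/subsetP => _ /imsetP[f Kf ->]; have [] := ctP f Kf.
- case=> n [E [v [gt1 E_inj v_inj EK vE]]].
  have /fin_all_exists[s sP] i : exists f, f \in K /\ E i = t f.
    by have /imsetP[f Kf Ei] := EK i; exists f.
  case: n gt1 E v E_inj v_inj EK vE s sP => [//|n] gt0 E v E_inj v_inj EK vE s sP.
  (* Along a Berge-cycle, the triangles after the first link [v ord0] to [v ord_max] off the
     fundamental cycle of the first. Both vertices lie in the first triangle, so [sep] is
     violated. *)
  have conv k (ltk : k < n.+1) :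
      connect (adjF (F :\: cycle_edges (C (s ord0)))) (v ord0) (v (Ordinal ltk)).
    elim: k ltk => [|k IH] ltk.
      by have -> : Ordinal ltk = ord0 by apply: val_inj.
    have ltk' := ltnW ltk; apply: connect_trans (IH ltk') _.
    have [Ks Es] := sP (Ordinal ltk); have [K0 E0] := sP ord0.
    apply: (conC _ (s (Ordinal ltk))) => //.
    + by apply/eqP => s0; have /E_inj : E ord0 = E (Ordinal ltk) by rewrite E0 Es s0.
    + rewrite -Es; have [_] := vE (Ordinal ltk').
      by have -> : ordS (Ordinal ltk') = Ordinal ltk by apply: val_inj; rewrite /= modn_small.
    by rewrite -Es; have [] := vE (Ordinal ltk).
  have [K0 E0] := sP ord0.
  have v0 : v ord0 \in t (s ord0) by rewrite -E0; have [] := vE ord0.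
  have vn : v ord_max \in t (s ord0).
    rewrite -E0; have [_] := vE ord_max.
    by have -> : ordS (@ord_max n) = ord0 by apply: val_inj; rewrite /= modnn.
  have nv : v ord0 != v ord_max.
    by apply/eqP => /v_inj/(congr1 val)/= n0; move: gt0; rewrite -n0.
  by case/negP: (sep _ _ _ K0 v0 vn nv); apply: conv.
rewrite card_in_imset // -cF0 addSn; congr _.+1.
by rewrite cardsD (setIidPr sF0) subnKC // subset_leq_card.
Qed.

End Counting.

(** * Assembling the cactus property and the two bounds *)

Theorem mainTheorem10 (T : finType) (e : rel T)
  (e_sym : symmetric e) (e_irr : irreflexive e)
  (G_conn : connected_rel e) (G_chordal : chordal e)
  (E' : {set {set T}})
  (E'_sub : E' \subset triangles e) (E'_acyc : berge_acyclic E')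
  (E'_max : forall E'' : {set {set T}}, E'' \subset triangles e ->
              berge_acyclic E'' -> #|E''| <= #|E'|)
  (X : {set {set T}})
  (X_reach : connect (grow_step e) (Gprime e E') X)
  (X_done : connected_rel (adjF X)) :
  spanning_cactus e X /\
  (forall F : {set {set T}}, spanning_cactus e F -> #|F| <= #|X|).
Proof.
have [sGX sXE cycX] := grow_steps_invariant e_sym X_reach (Gprime_Eset e_sym E'_sub).
split.
  (* Both cycles are triangles of [E']; sharing an edge means sharing two vertices, so they are the
     same hyperedge. *)
  split=> //; split=> // f S1 S2 /cycX/(Gprime_cycle e_sym e_irr G_chordal E'_sub E'_acyc)[h1 A1 ->].
  case/cycX/(Gprime_cycle e_sym e_irr G_chordal E'_sub E'_acyc)=> h2 A2 ->.
  case/imsetP=> -[x y]; rewrite inE /= => /andP[nxy /existsP[h /and3P[]]].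
  rewrite inE => /eqP-> xh yh ->; rewrite -[_ \in _]/(adjF _ _ _) adjF_hyp_edges.
  case/andP=> _ /existsP[h' /and3P[]]; rewrite inE => /eqP-> xh' yh'.
  by rewrite (berge_acyclic_linear E'_acyc A1 A2 nxy).
(* The spanning trees need a root [x0]; on an empty vertex set there are no edges at all. *)
move=> F cF; have [x0 _|T0] := pickP [pred x : T | true]; last first.
  have [sFE _] := cF; apply: leq_trans (subset_leq_card sFE) _.
  rewrite (_ : Eset e = set0) ?cards0 //.
  by apply/setP => f; rewrite inE; apply/imsetP => -[[x]]; have := T0 x.
have [A [sA acA cA]] := card_cactus_triangles e_sym e_irr G_chordal x0 cF.
rewrite -ltnS cA; apply: leq_trans (leq_add (leqnn _) (E'_max A sA acA)) _.
apply: card_linear_triangles x0 E'_sub E'_acyc _ X_done.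
exact: subset_trans (subsetUl _ _) sGX.
Qed.
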